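(* Let $j \geq 0$ be an integer and let $\Gamma$ be a graph. Then the graph monoid $M(\Gamma)$ satisfies $\phi(\overline{E_{0,j}})$ if and only if $\overline{E_{0,j}}$ embeds in $\Gamma$.
   Context: A graph $\Gamma$ is a set $V(\Gamma)$ of vertices together with a reflexive, symmetric relation $E(\Gamma) \subseteq V(\Gamma) \times V(\Gamma)$; vertices $u,v$ are adjacent if $(u,v) \in E(\Gamma)$ (so each vertex is adjacent to itself). The degree of a vertex is the number of vertices adjacent to and distinct from it. An embedding of graphs is a map on vertices which is injective and preserves both adjacency and non-adjacency. The complement $\overline{\Gamma}$ has the same vertex set as $\Gamma$, with two distinct vertices adjacent exactly if they are not adjacent in $\Gamma$. For integers $i,j \geq 0$, $E_{i,j}$ is the unique graph with exactly $i$ vertices of degree $0$ and $2j$ vertices of degree $1$ (and no other vertices); thus $\overline{E_{0,j}}$ is the graph on $2j$ vertices obtained from the complete graph by removing a perfect matching. The graph monoid (trace monoid) $M(\Gamma)$ is the monoid with presentation $\langle V(\Gamma) \mid ab = ba \text{ for all } (a,b) \in E(\Gamma) \rangle$. For a graph $\Omega$, a monoid $M$ satisfies $\phi(\Omega)$ if there is a function $\sigma : V(\Omega) \to M$ such that $u,v \in V(\Omega)$ are adjacent if and only if $\sigma(u)$ and $\sigma(v)$ commute. *)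

(* Defs.v *)
From HB Require Import structures.
From mathcomp Require Import all_boot generic_quotient monoid.
From mathcomp Require Import boolp classical_sets functions cardinality.

Set Implicit Arguments.
Unset Strict Implicit.
Unset Printing Implicit Defensive.

Local Open Scope card_scope.

(* Graphs are reflexive: every vertex is adjacent to itself.  The vertex type
   is arbitrary, possibly empty or infinite. *)
Record graph := Graph {
  vertex :> Type;
  adj : vertex -> vertex -> Prop;
  adj_refl : forall u, adj u u;
  adj_sym : forall u v, adj u v -> adj v u
}.
Arguments adj {g} u v.

Definition has_degree (G : graph) (v : G) (n : nat) : Prop :=
  ([set u : G | adj v u /\ u <> v] #= `I_n)%classic.

Definition embedding (G H : graph) (f : G -> H) : Prop :=
  injective f /\ forall u v, adj u v <-> adj (f u) (f v).

Definition embeds (G H : graph) : Prop := exists f : G -> H, embedding f.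

Section Complement.
Variable G : graph.

Definition compl_adj (u v : G) : Prop := u = v \/ ~ adj u v.

Lemma compl_adj_refl u : compl_adj u u.
Proof. by left. Qed.

Lemma compl_adj_sym u v : compl_adj u v -> compl_adj v u.
Proof. by case=> [->|nuv]; [left|right => /adj_sym]. Qed.

Definition compl : graph := Graph compl_adj_refl compl_adj_sym.
End Complement.

(* E_{i,j}: the vertices [inl _] are isolated, and each k : 'I_j contributes
   one edge, joining [inr (k, false)] to [inr (k, true)]. *)
Section EGraph.
Variables i j : nat.

Definition E_vertex : Type := ('I_i + 'I_j * bool)%type.

Definition E_adj (u v : E_vertex) : Prop :=
  match u, v with
  | inl a, inl b => a = b
  | inr p, inr q => p.1 = q.1
  | _, _ => False
  end.

Lemma E_adj_refl u : E_adj u u.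
Proof. by case: u. Qed.

Lemma E_adj_sym u v : E_adj u v -> E_adj v u.
Proof. by case: u v => [a|p] [b|q]. Qed.

Definition E : graph := Graph E_adj_refl E_adj_sym.

Lemma E_degree0 (a : 'I_i) : has_degree (inl a : E) 0.
Proof.
rewrite /has_degree II0 card_eq0; apply/eqP/seteqP; split=> //.
by move=> [b|q] /= [] // ->.
Qed.

Lemma E_degree1 (p : 'I_j * bool) : has_degree (inr p : E) 1.
Proof.
rewrite /has_degree.
suff -> : ([set u : E | adj (inr p : E) u /\ u <> inr p] =
           [set (inr (p.1, ~~ p.2) : E)])%classic by exact: card_set1.
apply/seteqP; split=> [|_ ->] /=; last first.
  by split=> // -[]; case: p => [k []].
case: p => [l c] [b|[k b]] /= [] // <- ne.
by congr (inr (_, _)); case: b c ne => [] [].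
Qed.
End EGraph.

(* The monoid < X | u = v for all (u, v) with R u v >: words over X modulo the
   smallest congruence containing R.  The alias {classic X} is X itself, equipped
   with the choice structure needed to form a quotient type. *)
Section PresentedMonoid.
Variables (X : Type) (R : seq X -> seq X -> Prop).

Inductive pres_cong : seq X -> seq X -> Prop :=
| pres_rel u v of R u v : pres_cong u v
| pres_refl u : pres_cong u u
| pres_sym u v of pres_cong u v : pres_cong v u
| pres_trans u v w of pres_cong u v & pres_cong v w : pres_cong u w
| pres_cat u u' v v' of pres_cong u u' & pres_cong v v' :
    pres_cong (u ++ v) (u' ++ v').

Definition word : choiceType := seq {classic X}.

Definition word_eqv (u v : word) : bool := `[< pres_cong u v >].

Lemma word_eqv_refl : reflexive word_eqv.
Proof. by move=> u; apply/asboolP/pres_refl. Qed.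

Lemma word_eqv_sym : symmetric word_eqv.
Proof. by move=> u v; apply/asboolP/asboolP => /pres_sym. Qed.

Lemma word_eqv_trans : transitive word_eqv.
Proof. by move=> v u w /asboolP uv /asboolP /(pres_trans uv) /asboolP. Qed.

Canonical word_equiv :=
  EquivRel word_eqv word_eqv_refl word_eqv_sym word_eqv_trans.

Definition presented : Type := {eq_quot word_equiv}%qT.
HB.instance Definition _ := Choice.on presented.

Definition pres_class (u : seq X) : presented := (\pi_({eq_quot word_equiv}) (u : word))%qT.

Lemma pres_classP u v : pres_class u = pres_class v <-> pres_cong u v.
Proof.
split; first by move/eqmodP/asboolP.
by move=> uv; apply/eqmodP/asboolP.
Qed.

Lemma pres_class_surj (x : presented) : exists u, x = pres_class u.
Proof. by exists (repr x); rewrite /pres_class reprK. Qed.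

Definition pres_mul (x y : presented) : presented :=
  pres_class (repr x ++ repr y).

Lemma pres_mulE u v :
  pres_mul (pres_class u) (pres_class v) = pres_class (u ++ v).
Proof.
by apply/pres_classP; apply: pres_cat; apply/pres_classP; rewrite /pres_class reprK.
Qed.

Lemma pres_mulA : associative pres_mul.
Proof.
move=> x y z; have [u ->] := pres_class_surj x.
have [v ->] := pres_class_surj y; have [w ->] := pres_class_surj z.
by rewrite !pres_mulE catA.
Qed.

Lemma pres_mul1 : left_id (pres_class [::]) pres_mul.
Proof. by move=> x; have [u ->] := pres_class_surj x; rewrite pres_mulE. Qed.

Lemma pres_mul1r : right_id (pres_class [::]) pres_mul.
Proof.
by move=> x; have [u ->] := pres_class_surj x; rewrite pres_mulE cats0.
Qed.

HB.instance Definition _ :=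
  isMonoid.Build presented pres_mulA pres_mul1 pres_mul1r.
End PresentedMonoid.

Definition graph_rel (G : graph) (u v : seq G) : Prop :=
  exists a b : G, [/\ adj a b, u = [:: a; b] & v = [:: b; a]].

Definition graph_monoid (G : graph) : monoidType := presented (@graph_rel G).

Definition satisfies_phi (M : monoidType) (W : graph) : Prop :=
  exists s : W -> M, forall u v : W, adj u v <-> commute (s u) (s v).

(* Main.v *)
From mathcomp Require Import all_boot monoid.
From mathcomp Require Import boolp.
Require Import Defs.

Set Implicit Arguments.
Unset Strict Implicit.
Unset Printing Implicit Defensive.

(** Erasing all letters but two non-adjacent ones [p], [q] induces a morphism
from M(G) to the free monoid on {p, q}, and a trace is determined by these
projections together with the number of occurrences of each letter.  Hence for
each [k] the k-th non-commuting pair [x, y] of M(G) has non-commuting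
projections for some non-adjacent [p], [q].  Every other element [z] in the
image of sigma commutes with [x] and [y]; as centralizers of nontrivial elements
of a free monoid are commutative, [z] contains neither [p] nor [q].  Two letters
chosen for different indices [k], [l] are then adjacent, because projecting on
them an element of the k-th pair and one of the l-th pair that contain them
gives commuting nontrivial powers of each letter. *)

Section FreeMonoid.
Variable T : eqType.
Implicit Types (a : T) (u v w x y z : seq T).

Lemma cat_flatten_nseqC n x z :
  x ++ z = z ++ x -> x ++ flatten (nseq n z) = flatten (nseq n z) ++ x.
Proof.
move=> xz; elim: n => [|n IHn] /=; first by rewrite cats0.
by rewrite catA xz -!catA IHn.
Qed.

Lemma take_commuting u w : size u <= size w -> u ++ w = w ++ u -> u = take (size u) w.
Proof.
move=> le_uw /(congr1 (take (size u))).
by rewrite take_size_cat // takel_cat.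
Qed.

(* [x ++ y] and [y ++ x] are prefixes of equal length of a high power of [z]. *)
Lemma free_centralizer_comm x y z :
  z != [::] -> x ++ z = z ++ x -> y ++ z = z ++ y -> x ++ y = y ++ x.
Proof.
move=> z_n0 xz yz; set w := flatten (nseq (size x + size y) z).
have le_w : size x + size y <= size w.
  by rewrite size_flatten /shape map_nseq sumn_nseq leq_pmull // lt0n size_eq0.
have xw : x ++ w = w ++ x by exact: cat_flatten_nseqC.
have yw : y ++ w = w ++ y by exact: cat_flatten_nseqC.
have -> : x ++ y = take (size (x ++ y)) w.
  by apply: take_commuting; rewrite ?size_cat // -catA yw catA xw catA.
have -> : y ++ x = take (size (y ++ x)) w.
  apply: take_commuting; first by rewrite size_cat addnC.
  by rewrite -catA xw catA yw catA.
by rewrite !size_cat addnC.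
Qed.

Lemma catC_pred1 a u v : all (pred1 a) u -> all (pred1 a) v -> u ++ v = v ++ u.
Proof. by move=> /all_pred1P-> /all_pred1P->; rewrite !cat_nseq /ncons -!iterD addnC. Qed.

(** The case [p = q] is allowed: the projection is then a power of [p] that records how often [p]
    occurs. *)
Definition proj p q u := [seq x <- u | (x == p) || (x == q)].

Lemma proj_cat p q u v : proj p q (u ++ v) = proj p q u ++ proj p q v.
Proof. exact: filter_cat. Qed.

Lemma all_proj p q u : q \notin u -> all (pred1 p) (proj p q u).
Proof.
move=> qu; apply/allP => x; rewrite mem_filter => /andP[/orP[//|/eqP->]].
by rewrite (negPf qu).
Qed.

Lemma projC p q u : proj p q u = proj q p u.
Proof. by apply: eq_filter => x; rewrite orbC. Qed.

Lemma projs1 p u : all (pred1 p) (proj p p u).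
Proof. by apply/allP => x; rewrite mem_filter /= orbb => /andP[]. Qed.

Lemma proj_eq0 p q u : proj p q u = [::] -> (p \notin u) * (q \notin u).
Proof.
move=> e; split; apply/negP => h;
  suff: (p \in proj p q u) || (q \in proj p q u) by rewrite e.
- by rewrite mem_filter eqxx h.
- by rewrite !mem_filter !eqxx h !orbT.
Qed.

(** The projections are nontrivial powers of [p] and of [q], so the two products begin with [p] and
    with [q] respectively. *)
Lemma proj_comm_disjoint p q u v :
  p \in u -> q \notin u -> q \in v -> p \notin v ->
  proj p q u ++ proj p q v = proj p q v ++ proj p q u -> p = q.
Proof.
move=> pu qu qv pv.
have := all_proj p qu; have := all_proj q pv.
rewrite (projC q p); have: p \in proj p q u by rewrite mem_filter eqxx.
have: q \in proj p q v by rewrite mem_filter eqxx orbT.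
case: (proj p q u) (proj p q v) => [|a u'] [|b v'] //= _ _.
by move=> /andP[/eqP-> _] /andP[/eqP-> _] [].
Qed.

End FreeMonoid.

Section Traces.
Variable G : graph.
Let V : eqType := {classic G}.
Implicit Types (a p q : V) (u v : seq V).
Let cong (u v : seq V) : Prop := pres_cong (@graph_rel G) u v.

(** If both letters of an elementary swap survive the projection, they are equal, since [p] and [q]
    are not adjacent. *)
Lemma cong_proj (p q : V) u v : ~ @adj G p q -> cong u v -> proj p q u = proj p q v.
Proof.
move=> npq; elim=> {u v} [u v|u|u v _ //|u v w _ -> _ -> //|u u' v v' _ IHu _ IHv].
- case=> a [b [ab -> ->]]; rewrite /proj /=.
  do 2!case: ifP => //; move=> /orP[]/eqP eb /orP[]/eqP ea; subst=> //.
  by have := adj_sym ab.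
- by [].
- by rewrite !proj_cat IHu IHv.
Qed.

Lemma cong_swap (a : V) u : (forall c, c \in u -> @adj G a c) ->
  cong (a :: u) (rcons u a).
Proof.
elim: u => [|c u IHu] au; first exact: pres_refl.
apply: (@pres_trans _ _ _ (c :: a :: u)).
  apply: (@pres_cat _ _ [:: a; c] [:: c; a] u u); last exact: pres_refl.
  by apply: pres_rel; exists a, c; split=> //; apply/au/mem_head.
apply: (@pres_cat _ _ [:: c] [:: c]); first exact: pres_refl.
by apply: IHu => d du; apply: au; rewrite inE du orbT.
Qed.

(** Induction on [u]: its first letter [a] occurs in [v] and commutes with everything before its
    first occurrence there, so it can be moved to the front of [v] and cancelled. *)
Lemma proj_cong u v :
  (forall p q : V, p = q \/ ~ @adj G p q -> proj p q u = proj p q v) -> cong u v.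
Proof.
elim: u v => [|a u IHu] v puv.
  case: v puv => [_|a v]; first exact: pres_refl.
  by move=> /(_ a a (or_introl erefl)); rewrite /proj /= eqxx.
have av : a \in v.
  have: a \in proj a a (a :: u) by rewrite mem_filter eqxx mem_head.
  by rewrite puv; [rewrite mem_filter => /andP[]|left].
have [v1 [v2 [ev av1]]] : exists v1 v2, v = v1 ++ a :: v2 /\ a \notin v1.
  move: av; rewrite -has_pred1; case/split_find=> _ v1 v2 /eqP->.
  by rewrite has_pred1 cat_rcons; exists v1, v2.
have av1_adj c : c \in v1 -> @adj G a c.
  move=> cv1; apply: contrapT => nac.
  (* On the letters [a] and [c], the projection of [a :: u] starts with [a], that of [v] with
     [c]. *)
  have := puv a c (or_intror nac); rewrite ev proj_cat {1}/proj /= eqxx /= (projC a c v1).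
  have := all_proj c av1.
  have: c \in proj c a v1 by rewrite mem_filter eqxx.
  case: (proj c a v1) => [|d w] //= _ /andP[/eqP-> _] [ac _].
  by apply: nac; rewrite ac; exact: adj_refl.
have cong_v : cong (a :: v1 ++ v2) v.
  rewrite ev -cat_rcons -cat_cons; apply: pres_cat; last exact: pres_refl.
  exact: cong_swap.
apply: (pres_trans _ cong_v).
apply: (@pres_cat _ _ [:: a] [:: a]); first exact: pres_refl.
apply: IHu => p q pq; have := puv p q pq.
have -> : proj p q v = proj p q (a :: v1 ++ v2).
  case: (pq) => [<-|npq]; last exact: esym (cong_proj npq cong_v).
  rewrite ev -(cat1s a v2) -(cat1s a (v1 ++ v2)) !proj_cat !catA; congr (_ ++ _).
  by apply: catC_pred1; exact: projs1.
by rewrite /proj /=; case: ifP => // _ [].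
Qed.

Lemma class_commute (u v : seq G) :
  commute (pres_class (@graph_rel G) u : graph_monoid G) (pres_class (@graph_rel G) v)
    <-> cong (u ++ v) (v ++ u).
Proof.
have mulE x y : (pres_class (@graph_rel G) x * pres_class (@graph_rel G) y)%g =
    pres_class (@graph_rel G) (x ++ y) by exact: pres_mulE.
by rewrite /commute !mulE; exact: pres_classP.
Qed.

(** Projections on a single letter always commute, so the obstruction comes from a non-adjacent
    pair. *)
Lemma noncomm_proj u v : ~ cong (u ++ v) (v ++ u) ->
  exists p q : V, ~ @adj G p q /\
    proj p q u ++ proj p q v <> proj p q v ++ proj p q u.
Proof.
move=> nuv; apply: contrapT => nex; apply: nuv; apply: proj_cong => p q pq.
rewrite !proj_cat; case: pq => [<-|npq]; first by apply: catC_pred1; exact: projs1.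
by apply: contrapT => ne; apply: nex; exists p, q.
Qed.

End Traces.

Lemma adj_commute_letters (G : graph) (a b : G) :
  adj a b <->
  commute (pres_class (@graph_rel G) [:: a] : graph_monoid G)
          (pres_class (@graph_rel G) [:: b]).
Proof.
split=> [ab|/class_commute ab].
  by apply/class_commute/pres_rel; exists a, b.
apply: contrapT => nab; apply: (nab).
(* Projecting on [a] and [b] erases nothing, so the words [ab] and [ba] coincide and [a = b]. *)
have := cong_proj nab ab; rewrite /proj /= !eqxx !orbT /= => -[-> _].
exact: adj_refl.
Qed.

Lemma compl_E0_adj_diff j (k l : 'I_j) (b c : bool) : k <> l ->
  @adj (compl (E 0 j)) (inr (k, b)) (inr (l, c)).
Proof. by move=> kl; right. Qed.

Lemma compl_E0_nadj j (k : 'I_j) (b : bool) :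
  ~ @adj (compl (E 0 j)) (inr (k, b)) (inr (k, ~~ b)).
Proof. by case; [case; case: b | apply]. Qed.

Theorem theorem15 (j : nat) (G : graph) :
  satisfies_phi (graph_monoid G) (compl (E 0 j)) <-> embeds (compl (E 0 j)) G.
Proof.
split=> [[s s_adj]|[f [_ f_adj]]]; last first.
  exists (fun u => pres_class (@graph_rel G) [:: f u]) => u v.
  by rewrite f_adj; exact: adj_commute_letters.
pose V : eqType := {classic G}.
have /choice[w s_w] u : exists x : seq V, s u = pres_class (@graph_rel G) x.
  exact: pres_class_surj.
have w_adj u v : adj u v <-> pres_cong (@graph_rel G) (w u ++ w v) (w v ++ w u).
  by rewrite s_adj !s_w; exact: class_commute.
have /choice[g g_spec] k : exists pq : V * V,
    let: (p, q) := pq in let: x := w (inr (k, false)) in let: y := w (inr (k, true)) in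
    ~ @adj G p q /\ proj p q x ++ proj p q y <> proj p q y ++ proj p q x.
  have [|p [q pq]] := @noncomm_proj G (w (inr (k, false))) (w (inr (k, true))).
    by move/w_adj; exact: compl_E0_nadj.
  by exists (p, q).
pose h (k : 'I_j) (b : bool) : V := if b then (g k).2 else (g k).1.
have h_nadj k b : ~ @adj G (h k b) (h k (~~ b)).
  have := g_spec k; rewrite /h; case: (g k) => p q [npq _].
  by case: b => //= /adj_sym.
(* If the letter were missing from both words of the pair, their projections would be powers of the
   other letter and commute. *)
have h_occurs k b : exists c, h k b \in w (inr (k, c)).
  apply: contrapT => nex.
  have ninw c : h k b \notin w (inr (k, c)) by apply/negP => hin; apply: nex; exists c.
  have := g_spec k; move: (ninw); rewrite /h; case: (g k) => p q {}ninw [_]; apply.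
  by case: b {nex} ninw => /= ninw; [|rewrite !(projC p)];
    apply: catC_pred1; exact: all_proj.
(* Otherwise both projections of the k-th pair would centralize a nonempty word, hence commute. *)
have h_absent k l b c : k <> l -> h k b \notin w (inr (l, c)).
  move=> kl; have := g_spec k; rewrite /h; case: (g k) => p q [npq ncomm].
  suff /proj_eq0[? ?] : proj p q (w (inr (l, c))) = [::] by case: b.
  apply: contrapT => /eqP n0; apply: ncomm; apply: (free_centralizer_comm n0);
    by rewrite -!proj_cat; apply: (cong_proj npq); apply/w_adj/compl_E0_adj_diff.
have h_adj k l b c : k <> l -> @adj G (h k b) (h l c).
  move=> kl; apply: contrapT => nadj.
  (* A chosen letter may occur in either word of its pair, so [b'] need not be [b]. *)
  have [b' hb] := h_occurs k b; have [c' hc] := h_occurs l c.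
  suff e : h k b = h l c by apply: nadj; rewrite e; exact: adj_refl.
  apply: (proj_comm_disjoint hb _ hc); [exact/h_absent/nesym|exact: h_absent|].
  by rewrite -!proj_cat; apply: (cong_proj nadj); apply/w_adj/compl_E0_adj_diff.
exists (fun u : compl (E 0 j) => match u with
  | inl i => False_rect _ (notF (ltn_ord i))
  | inr (k, b) => h k b
  end).
have h_compl k l b c :
    @adj (compl (E 0 j)) (inr (k, b)) (inr (l, c)) <-> @adj G (h k b) (h l c).
  have [<-|/eqP kl] := eqVneq k l; last first.
    by split=> _; [exact: h_adj|exact: compl_E0_adj_diff].
  have [<-|bc] := eqVneq b c; first by split=> _; exact: adj_refl.
  have -> : c = ~~ b by case: b c bc => [] [].
  by split=> [/compl_E0_nadj|/h_nadj].
split=> [[[]//|[k b]] [[]//|[l c]] e|[[]//|[k b]] [[]//|[l c]]]; last exact: h_compl.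
have [kl|/eqP kl] := eqVneq k l; last first.
  (* A letter shared by two pairs would be adjacent to its own partner. *)
  by have := h_adj k l (~~ b) c kl; rewrite -e => /adj_sym /h_nadj.
move: e; rewrite -kl; have [<- //|bc] := eqVneq b c.
have -> : c = ~~ b by case: b c bc => [] [].
by move=> e; case: (h_nadj k b); rewrite -e; exact: adj_refl.
Qed.
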